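(* Let $u$ be a word and $v$ a non-commutator word, where $u$ and $v$ involve disjoint sets of variables. (1) If $u$ is concise in profinite groups, then the word $[u,v]$ is concise in profinite groups. (2) If $u$ is boundedly concise in profinite groups, then the word $[u,v]$ is boundedly concise in profinite groups.
   Context: For a group-word $w=w(x_1,\dots,x_k)$ and a group $G$, $G_w=\{w(g_1,\dots,g_k): g_i\in G\}$ is the set of $w$-values in $G$. For a profinite group $G$, $w(G)$ denotes the minimal closed subgroup of $G$ containing $G_w$. A word $w$ is concise in profinite groups if $w(G)$ is finite for every profinite group $G$ such that $G_w$ is finite. A word $w$ is boundedly concise in profinite groups if for every integer $m$ there exists a number $\nu=\nu(w,m)$ such that whenever $|G_w|\le m$ for a profinite group $G$ it follows that $|w(G)|\le \nu$. A non-commutator word is a word such that the sum of the exponents of some variable involved in it is non-zero. $[x,y]=x^{-1}y^{-1}xy$. *)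

(* Defs.v *)
From HB Require Import structures.
From mathcomp Require Import all_boot all_algebra all_classical topology.

Set Implicit Arguments.
Unset Strict Implicit.
Unset Printing Implicit Defensive.

Local Open Scope classical_set_scope.
Local Open Scope group_scope.
Local Open Scope card_scope.

HB.mixin Record isTopologicalGroup G of Group G & Topological G := {
  mulg_continuous : continuous (fun xy : G * G => xy.1 * xy.2);
  invg_continuous : continuous (fun x : G => x^-1)
}.

#[short(type="topologicalGroupType")]
HB.structure Definition TopologicalGroup :=
  {G of Group G & Topological G & isTopologicalGroup G}.

HB.mixin Record isProfinite G of TopologicalGroup G := {
  profinite_compact : compact [set: G];
  profinite_hausdorff : hausdorff_space G;
  profinite_totally_disconnected : totally_disconnected [set: G]
}.

#[short(type="profiniteGroupType")]
HB.structure Definition ProfiniteGroup :=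
  {G of TopologicalGroup G & isProfinite G}.

(* The letter (i, false) stands for x_i and (i, true) for x_i^-1. Words need
   not be reduced: cancelling x_i x_i^-1 changes neither the values of a word
   nor its exponent sums, and introduces no new variable. *)
Definition word := seq (nat * bool).

Definition word_inv (w : word) : word := rev [seq (l.1, ~~ l.2) | l <- w].

Definition word_comm (u v : word) : word := word_inv u ++ word_inv v ++ u ++ v.

Definition word_vars (w : word) : seq nat := [seq l.1 | l <- w].

Definition disjoint_vars (u v : word) : Prop :=
  forall i, ~ (i \in word_vars u /\ i \in word_vars v).

Definition exponent_sum (w : word) (i : nat) : int :=
  (\sum_(l <- w | l.1 == i) (-1) ^+ l.2)%R.

Definition non_commutator_word (w : word) : Prop :=
  exists2 i, i \in word_vars w & exponent_sum w i <> 0%R.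

Section Values.
Context {G : groupType}.

(* The assignment g gives a value to every x_i; only those of the variables
   of w matter. *)
Definition word_eval (w : word) (g : nat -> G) : G :=
  \prod_(l <- w) (if l.2 then (g l.1)^-1 else g l.1).

Definition word_values (w : word) : set G := range (word_eval w).

End Values.

Definition closed_subgroup {G : topologicalGroupType} (H : set G) : Prop :=
  group_closed (mem H) /\ closed H.

Definition verbal_subgroup (G : topologicalGroupType) (w : word) : set G :=
  smallest closed_subgroup (word_values w).

Definition concise_in_profinite (w : word) : Prop :=
  forall G : profiniteGroupType,
    finite_set (@word_values G w) -> finite_set (@verbal_subgroup G w).

Definition boundedly_concise_in_profinite (w : word) : Prop :=
  forall m : nat, exists nu : nat, forall G : profiniteGroupType,
    @word_values G w #<= `I_m -> @verbal_subgroup G w #<= `I_nu.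

(* Main.v *)
Require Import Defs.
From HB Require Import structures.
From mathcomp Require Import all_boot all_algebra all_classical topology.

(* Let X be the finite set of values of [u,v] in G, K = C(X), L = C(K) and
   A = K \cap L. Then X is contained in L, and A is a central subgroup of L of
   bounded index. Every power g^E, for a suitable E > 0, is a value of v, so by
   the pigeonhole principle g^N commutes with all values of u, for a bounded N.
   If a is a value of u and g is in K, with [a',g] in L for all values a' of u,
   then [a,g]^N = [a,g^N] = 1, so that [a,g] lies in the N-torsion subgroup Om
   of A. Hence, modulo Om, the commutator of a with a value b of v depends only
   on the class of b modulo K, and if D is the subgroup of the elements that
   centralise the values of v modulo Om then u has boundedly many values in G/D.
   Conciseness of u bounds u(G/D), and so a bounded power of each c = [a,b] in X
   lies in D; a further bounded power of it lies in A and commutes with b.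
   Applying the transfer from L to A to
   1 = [a,b^N] = c c^b ... c^(b^(N-1)) bounds the order of c,
   and Dietzmann's lemma bounds the subgroup generated by X. *)

Import GRing.Theory.

Set Implicit Arguments.
Unset Strict Implicit.
Unset Printing Implicit Defensive.

Local Open Scope classical_set_scope.
Local Open Scope group_scope.
Local Open Scope card_scope.

(** * Topology of profinite groups *)

Lemma group_closed_mem (G : groupType) (H : set G) :
  group_closed (mem H) <-> [/\ H 1, forall x y, H x -> H y -> H (x * y)
                                & forall x, H x -> H x^-1].
Proof.
split=> [gH|[H1 HM HV]]; last first.
  split=> [|x y]; rewrite !inE // => Hx Hy; exact/HM/HV.
have [] := gH; rewrite inE => H1 _; split=> // [x y Hx Hy|x Hx].
- by apply: set_mem; apply: (group_closedM gH); apply: mem_set.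
- by apply: set_mem; apply: (group_closedV gH); apply: mem_set.
Qed.

Lemma continuous_mulg (T : topologicalType) (G : topologicalGroupType)
    (f g : T -> G) :
  continuous f -> continuous g -> continuous (fun x => f x * g x).
Proof.
move=> cf cg x.
apply: (@continuous_comp _ _ _ (fun x => (f x, g x)) (fun p => p.1 * p.2)).
  by apply: cvg_pair; [exact: cf|exact: cg].
exact: mulg_continuous.
Qed.

Lemma continuous_invg (T : topologicalType) (G : topologicalGroupType)
    (f : T -> G) : continuous f -> continuous (fun x => (f x)^-1).
Proof.
by move=> cf x; apply: continuous_comp; [exact: cf|exact: invg_continuous].
Qed.

(** In a compact Hausdorff space quasi-components are connected, so total disconnectedness shrinks
    them to points. *)
Lemma compact_zero_dimensional (T : topologicalType) :
  hausdorff_space T -> compact [set: T] -> totally_disconnected [set: T] ->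
  zero_dimensional T.
Proof.
move=> hT cT dT x y xy.
(* The intersection Q of the clopen neighbourhoods of x is connected. *)
pose Q : set T := \bigcap_(C in [set C | clopen C /\ C x]) C.
suff Qx : Q `<=` [set x].
  apply: contrapT => nU; have : Q y.
    by move=> C [cC Cx]; apply: contrapT => nCy; apply: nU; exists C.
  by move/Qx => /= yx; rewrite yx eqxx in xy.
have Qcl : closed Q by apply: closed_bigI => C [[]].
have Qself : Q x by move=> C [].
(* Compactness: otherwise the sets [C \ U] form a proper filter base. A cluster point lies in every
   clopen [C] around [x], hence in [Q], but not in the open set [U]. *)
have Qnbh (U : set T) : open U -> Q `<=` U ->
    exists C, [/\ clopen C, C x & C `<=` U].
  move=> oU QU.
  apply: contrapT => nC.
  pose F' := filter_from [set C : set T | C x /\ clopen C] (fun C => C `\` U).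
  have PF' : ProperFilter F'.
    apply: filter_from_proper.
      apply: filter_from_filter.
        by exists setT; split => //; exact: clopenT.
      move=> A B [Ax cA] [Bx cB]; exists (A `&` B).
        by split=> //; exact: clopenI.
      by move=> z [[Az Bz] Uz].
    move=> A [Ax cA]; apply/set0P/eqP => AU; apply: nC; exists A; split => //.
    by apply/subsetP => z; rewrite !inE => Az; apply: contrapT => nUz; 
      rewrite -[False]/(set0 z) -AU.
  have [|p [_ pc]] := @cT F'.
    by exists setT => //; split => //; exact: clopenT.
  have Up : U p.
    apply: QU => C [[oC cC] Cx]; rewrite ((closure_id C).1 cC).
    move=> N Np; apply: (pc C N) => //; exists C => //=; exact: subDsetl.
  have [|z [nUz Uz]] := pc (~` U) U _ (open_nbhs_nbhs (conj oU Up)).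
    by exists setT; [split => //; exact: clopenT|rewrite setTD].
  exact: nUz.
rewrite -(dT x I); apply: connected_component_max => //.
apply/connectedP => E [E0 QE [E1 E2]].
wlog Ex : E E0 QE E1 E2 / E false x => [wl|].
  have : Q x by [].
  rewrite [in X in X -> _]QE => -[/wl|Ex]; first exact.
  apply: (wl (fun b => E (~~ b))) => //.
  - by rewrite setUC.
  - by rewrite setIC.
  - by rewrite setIC.
have clE b : closed (E b).
  have EQ c : closure (E c) `<=` Q.
    rewrite [in X in _ `<=` X]((closure_id Q).1 Qcl).
    apply: closureS; rewrite QE; case: c.
      exact: subsetUr.
    exact: subsetUl.
  rewrite closure_id; apply/seteqP; split; first exact: subset_closure.
  move=> z Ez; have := EQ b z Ez; rewrite QE => -[] Ez'; case: b Ez => // Ez.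
  - by suff : set0 z by []; rewrite -E2; split.
  - by suff : set0 z by []; rewrite -E1; split.
have nT := compact_normal hT cT.
have nE : set_nbhs (E false) (~` E true).
  move=> z Ez; apply: open_nbhs_nbhs; split; first exact: closed_openC.
  by move=> Ez'; suff : set0 z by []; rewrite -E1; split => //; 
    exact: subset_closure.
have [V nV Vcl] := nT (E false) (clE false) _ nE.
have [W [oW EW WV]] := (set_nbhsP _ _).1 nV.
(* Inside a clopen [C] contained in this [U], the sets [W] and [closure V] agree, so [C] meets [W]
   in a clopen neighbourhood of [x]. It contains [Q] and yet misses [E true]. *)
pose U := W `|` ~` closure V.
have [||C [[oC cC] Cx CU]] := Qnbh U.
- by apply: openU => //; exact/closed_openC/closed_closure.
- move=> z; rewrite QE => -[/EW|Ez]; [by left|right].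
  by move/Vcl; exact.
have : clopen (C `&` W).
  split; first exact: openI.
  have -> : C `&` W = C `&` closure V.
    apply/seteqP; split=> z [Cz].
      by move=> Wz; split => //; apply: subset_closure; exact: WV.
    by move=> Vz; split => //; case: (CU z Cz).
  by apply: closedI => //; exact: closed_closure.
move=> clCW; have [z Ez] := E0 true.
have Qz : Q z by rewrite QE; right.
have [_ Wz] := Qz (C `&` W) (conj clCW (conj Cx (EW _ Ex))).
exact: (Vcl z (subset_closure (WV _ Wz))).
Qed.

(** The complement is the union of the other left cosets, each of which is open. *)
Lemma open_coset_clopen (G : topologicalGroupType) (H : set G) (x : G) :
  open H -> group_closed (mem H) -> clopen [set g | H (x^-1 * g)].
Proof.
move=> oH /group_closed_mem[H1 HM HV].
have oc t : open [set g | H (t^-1 * g)].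
  have /continuousP : continuous (fun g : G => t^-1 * g).
    by apply: continuous_mulg => z; [exact: cvg_cst|exact: cvg_id].
  exact.
split=> //; rewrite -[X in closed X]setCK; apply: open_closedC.
have -> : ~` [set g | H (x^-1 * g)] =
    \bigcup_(t in [set t | ~ H (x^-1 * t)]) [set g | H (t^-1 * g)].
  apply/seteqP; split=> [t nHt|g [t nHt Htg] /= Hg].
    by exists t => //=; rewrite mulVg.
  apply: nHt; have := HM _ _ Hg (HV _ Htg).
  by rewrite invgM invgK !mulgA mulgK.
by apply: bigcup_open.
Qed.

Lemma open_subgroup_base (G : profiniteGroupType) (V : set G) :
  nbhs 1 V ->
  exists M : set G, [/\ open M, group_closed (mem M) & M `<=` V].
Proof.
have zG := compact_zero_dimensional (@profinite_hausdorff G)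
  (@profinite_compact G) (@profinite_totally_disconnected G).
case/(zero_dimensional_cvg (@profinite_hausdorff G) zG
  (@profinite_compact G)) => A /= [A1 [oA cA]] AV.
(* The stabiliser of the clopen set [A] under right translation; it lies in [A] because [1] does. *)
pose M : set G := [set g | forall h, A (h * g) <-> A h].
exists M; split.
(* [A] and its complement are open, so the condition at [h] persists near [(h, g)]; compactness
   makes the neighbourhood of [g] uniform in [h]. *)
- rewrite openE => g Mg.
  have /compact_near_coveringP nc := @profinite_compact G.
  have := nc G (nbhs g) (fun g' h => A (h * g') <-> A h).
  move=> /(_ _ _)/filterS; apply.
    by move=> g' Ag' h; exact: Ag'.
  move=> h _.
  have c1 : continuous (fun p : G * G => p.1 * p.2) := @mulg_continuous G.
  have c2 : continuous (fun p : G * G => p.1) by move=> p; exact: cvg_fst.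
  have key (B : set G) : open B -> B h -> B (h * g) ->
      \forall p \near (h, g), B (p.1 * p.2) /\ B p.1.
    move=> oB B1 B2; near=> p; split; near: p.
    + by apply: (c1 (h, g)); apply: open_nbhs_nbhs.
    + by apply: (c2 (h, g)); apply: open_nbhs_nbhs.
  have [Ah|nAh] := pselect (A h).
    by have := key A oA Ah ((Mg h).2 Ah); apply: filterS => p [].
  have nA : ~ A (h * g) by move/(Mg h).1.
  have := key (~` A) (closed_openC cA) nAh nA.
  by apply: filterS => p [/= ? ?]; split.
- apply/group_closed_mem; split=> [h|x y Mx My h|x Mx h].
  + by rewrite mulg1.
  + by rewrite mulgA; apply: (iff_trans (My _)); exact: Mx.
  + by rewrite -(Mx (h * x^-1)) mulgVK.
- by move=> g Mg; apply: AV; have := (Mg 1).2; rewrite mul1g; apply.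
Unshelve. all: by end_near.
Qed.

(** * Quotients by closed normal subgroups *)

Record closed_normal (G : profiniteGroupType) := ClosedNormal {
  cn_set : set G;
  cn_group : group_closed (mem cn_set);
  cn_conj : forall x g, cn_set x -> cn_set (x ^ g);
  cn_closed : closed cn_set
}.

Section Quotient.
Variables (G : profiniteGroupType) (D : closed_normal G).
Local Open Scope quotient_scope.
Local Notation inD := (cn_set D).

Let D1 : inD 1. Proof. by case/group_closed_mem: (cn_group D). Qed.
Let DM x y : inD x -> inD y -> inD (x * y).
Proof. by case/group_closed_mem: (cn_group D) => ? + ?; apply. Qed.
Let DV x : inD x -> inD x^-1.
Proof. by case/group_closed_mem: (cn_group D) => ? ?; apply. Qed.

Definition coset_rel : rel G := fun x y => `[< inD (x^-1 * y) >].

Lemma coset_rel_equiv : equiv_class_of coset_rel.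
Proof.
split=> [x|x y|y x z]; rewrite /coset_rel.
- by rewrite mulVg; apply/asboolP.
- by apply/asboolP/asboolP => /DV; rewrite invgM invgK.
- move=> /asboolP xy /asboolP yz; apply/asboolP.
  by have := DM xy yz; rewrite -mulgA mulVKg.
Qed.

Canonical coset_equiv := EquivRelPack coset_rel_equiv.

Definition quotient_group : Type := quotient_topology {eq_quot coset_equiv}.
Local Notation Q := quotient_group.

HB.instance Definition _ := Topological.on Q.
HB.instance Definition _ := Quotient.on Q.

Definition coset (x : G) : Q := \pi_({eq_quot coset_equiv}) x.

Lemma cosetP x y : coset x = coset y <-> inD (x^-1 * y).
Proof.
split=> [/eqmodP/asboolP//|xy]; apply/eqmodP; exact/asboolP.
Qed.

Lemma coset_surj (q : Q) : exists x, coset x = q.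
Proof. by exists (repr q); exact: reprK. Qed.

Definition qone : Q := coset 1.
Definition qmul (p q : Q) : Q := coset (repr p * repr q).
Definition qinv (p : Q) : Q := coset (repr p)^-1.

Let reprP x : inD (x^-1 * repr (coset x)).
Proof. by apply/cosetP; rewrite /coset reprK. Qed.

Lemma coset_qmul x y : qmul (coset x) (coset y) = coset (x * y).
Proof.
apply/esym/cosetP; rewrite invgM.
have -> : y^-1 / x * (repr (coset x) * repr (coset y)) =
  (x^-1 * repr (coset x)) ^ y * (y^-1 * repr (coset y)).
  by rewrite conjgE !mulgA mulgK.
by apply: DM => //; apply: cn_conj.
Qed.

Lemma coset_qinv x : qinv (coset x) = coset x^-1.
Proof.
apply/esym/cosetP; rewrite invgK -[_ * _]invgK invgM invgK; apply: DV.
have -> : repr (coset x) / x = (x^-1 * repr (coset x)) ^ x^-1.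
  by rewrite conjgE invgK !mulgA mulgV mul1g.
exact: cn_conj.
Qed.

Let qmulA : associative qmul.
Proof.
move=> p q r; have [x <-] := coset_surj p.
have [[y <-] [z <-]] := (coset_surj q, coset_surj r).
by rewrite !coset_qmul mulgA.
Qed.
Let qmul1g : left_id qone qmul.
Proof. by move=> p; case: (coset_surj p) => x <-; rewrite coset_qmul mul1g. Qed.
Let qmulg1 : right_id qone qmul.
Proof. by move=> p; case: (coset_surj p) => x <-; rewrite coset_qmul mulg1. Qed.
Let qmulVg : left_inverse qone qinv qmul.
Proof.
by move=> p; case: (coset_surj p) => x <-; rewrite coset_qinv coset_qmul mulVg.
Qed.
Let qmulgV : right_inverse qone qinv qmul.
Proof.
by move=> p; case: (coset_surj p) => x <-; rewrite coset_qinv coset_qmul mulgV.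
Qed.

HB.instance Definition _ := isGroup.Build Q qmulA qmul1g qmulg1 qmulVg qmulgV.

Lemma cosetM : {morph coset : x y / x * y}.
Proof. by move=> x y; rewrite -coset_qmul. Qed.

HB.instance Definition _ := isGroupMorphism.Build G Q coset
  (fun x y => etrans (cosetM x y^-1)
     (congr1 (fun z => coset x * z) (esym (coset_qinv y)))).

Lemma coset_continuous : continuous coset.
Proof. exact: pi_continuous. Qed.

Lemma open_quotientE (U : set Q) : open U = open (coset @^-1` U).
Proof. by []. Qed.

Lemma coset_image_preimage (A : set G) :
  coset @^-1` (coset @` A) = \bigcup_(d in inD) [set x | A (x * d)].
Proof.
apply/seteqP; split=> [x [a Aa /esym/cosetP xa]|x [d Dd Axd]].
  by exists (x^-1 * a) => //=; rewrite mulVKg.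
by exists (x * d) => //; apply/esym/cosetP; rewrite mulKg.
Qed.

Lemma open_translate (A : set G) d : open A -> open [set x | A (x * d)].
Proof.
move=> oA; have /continuousP : continuous (fun x : G => x * d).
  by apply: continuous_mulg => x; [exact: cvg_id|exact: cvg_cst].
by apply.
Qed.

(** The saturation of an open set is a union of its translates. *)
Lemma coset_open (A : set G) : open A -> open (coset @` A).
Proof.
move=> oA; rewrite open_quotientE coset_image_preimage.
by apply: bigcup_open => d _; exact: open_translate.
Qed.

Lemma coset_nbhs x (A : set G) : nbhs x A -> nbhs (coset x) (coset @` A).
Proof.
rewrite nbhsE => -[B [oB Bx] BA]; rewrite nbhsE.
exists (coset @` B); last by move=> _ [b Bb <-]; exists b => //; exact: BA.
by split; [exact: coset_open|exists x].
Qed.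

Let qmul_continuous : continuous (fun pq : Q * Q => pq.1 * pq.2).
Proof.
move=> [p q]; case: (coset_surj p) (coset_surj q) => x <- [y <-] U /=.
rewrite -cosetM => /coset_continuous /= Uxy.
have [[A B] /= [Ax By] AB] := @mulg_continuous G (x, y) _ Uxy.
exists (coset @` A, coset @` B); first by split; exact: coset_nbhs.
move=> [_ _] /= [[a Aa <-] [b Bb <-]]; rewrite /= -cosetM.
exact: (AB (a, b)).
Qed.

Let qinv_continuous : continuous (fun p : Q => p^-1).
Proof.
apply/quotient_continuous => x /=.
have -> : (fun p : Q => p^-1) \o \pi_(quotient_topology {eq_quot coset_equiv})
    = coset \o (fun x : G => x^-1).
  by apply/funext => z; exact: coset_qinv.
by apply: continuous_comp; [exact: invg_continuous|exact: coset_continuous].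
Qed.

HB.instance Definition _ :=
  isTopologicalGroup.Build Q qmul_continuous qinv_continuous.

Let quotient_compact : compact [set: Q].
Proof.
have -> : [set: Q] = coset @` [set: G].
  by apply/seteqP; split=> // p _; case: (coset_surj p) => x <-; exists x.
apply: continuous_compact; last exact: profinite_compact.
exact/continuous_subspaceT/coset_continuous.
Qed.

(** As [D] is closed, some open subgroup [M] has [x^-1 y M] disjoint from it, and the image of [x M]
    separates the two cosets. Both the Hausdorff axiom and total disconnectedness follow from
    this. *)
Let quotient_zero_dimensional : zero_dimensional Q.
Proof.
move=> p q; case: (coset_surj p) (coset_surj q) => x <- [y <-] /eqP xy.
have nD : ~ inD (x^-1 * y) by move/cosetP.
have : nbhs 1 [set g | (~` inD) (x^-1 * y * g)].
  have c : continuous (fun g : G => x^-1 * y * g).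
    by apply: continuous_mulg => z; [exact: cvg_cst|exact: cvg_id].
  apply: c; rewrite mulg1; apply: open_nbhs_nbhs; split => //.
  exact/closed_openC/cn_closed.
case/open_subgroup_base => M [oM gM MV].
have [M1 MM MI] := (group_closed_mem _).1 gM.
exists [set p | (coset @` M) ((coset x)^-1 * p)]; split.
- apply: open_coset_clopen; first exact: coset_open.
  apply/group_closed_mem; split; first by exists 1 => //; exact: gmulf1.
  + move=> _ _ [a Ma <-] [b Mb <-]; exists (a * b); [exact: MM|exact: cosetM].
  + by move=> _ [a Ma <-]; exists a^-1; [exact: MI|exact: gmulfV].
- by exists 1 => //; rewrite gmulf1 mulVg.
- case=> g Mg; rewrite -gmulfV -cosetM => /cosetP gxy.
  apply: (MV g^-1 (MI _ Mg)).
  have := cn_conj g^-1 gxy; rewrite conjgE invgK !mulgA mulgV mul1g.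
  by [].
Qed.

Let quotient_hausdorff : hausdorff_space Q.
Proof.
rewrite open_hausdorff => p q /quotient_zero_dimensional[U [[oU cU] Up Uq]].
exists (U, ~` U); first by split; apply/mem_set.
by split => //=; [exact: closed_openC|apply/eqP; exact: setICr].
Qed.

HB.instance Definition _ := isProfinite.Build Q quotient_compact
  quotient_hausdorff
  (zero_dimension_totally_disconnected quotient_zero_dimensional).

End Quotient.

(** * Commutators, transfer and Dietzmann's lemma *)

Section Commutators.
Variable G : groupType.
Implicit Types x y z : G.

Lemma commMgJ x y z : [~ x * y, z] = [~ x, z] ^ y * [~ y, z].
Proof. by rewrite /commg /conjg !invgM !mulgA !gnorm. Qed.

Lemma commgMJ x y z : [~ x, y * z] = [~ x, z] * [~ x, y] ^ z.
Proof. by rewrite /commg /conjg !invgM !mulgA !gnorm. Qed.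

Lemma commVg x y : [~ x^-1, y] = ([~ x, y]^-1) ^ x^-1.
Proof. by rewrite /commg /conjg !gnorm. Qed.

Lemma commgV x y : [~ x, y^-1] = ([~ x, y]^-1) ^ y^-1.
Proof. by rewrite /commg /conjg !gnorm. Qed.

Lemma conjg_id_commute x y : x ^ y = x <-> commute x y.
Proof.
by split=> [/conjg_fixP/commgP//|/commgP/conjg_fixP].
Qed.

Lemma commutatorX_r x y n : commute [~ x, y] y -> [~ x, y ^+ n] = [~ x, y] ^+ n.
Proof.
move=> cxy; elim: n => [|n IH]; first by rewrite commg1.
rewrite expgS commgMJ IH expgSr; congr (_ * _).
exact/conjg_id_commute/commuteX.
Qed.

Lemma commutatorX_l x y n : commute [~ x, y] x -> [~ x ^+ n, y] = [~ x, y] ^+ n.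
Proof.
move=> cxy; elim: n => [|n IH]; first by rewrite comm1g.
rewrite expgS commMgJ IH expgS; congr (_ * _).
exact/conjg_id_commute/commuteX.
Qed.

End Commutators.

(** The bound on [d] makes it divide the factorial of [#|J|], an exponent uniform in [f]. *)
Lemma pigeonhole_period (J : finType) (f : nat -> J) :
  exists i d, [/\ (0 < d)%N, (d <= #|J|)%N & f i = f (i + d)].
Proof.
have : ~~ injectiveb [ffun i : 'I_#|J|.+1 => f i].
  apply/negP => /injectiveP/leq_card; rewrite card_ord ltnn //.
case/injectivePn => i [j ij]; rewrite !ffunE => fij.
wlog lij : i j ij fij / (i < j)%N => [wl|].
  move: (ij); rewrite -(inj_eq val_inj) neq_ltn => /orP[|ji]; first exact: wl.
  by apply: (wl j i); rewrite // eq_sym.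
exists i, (j - i)%N; split; first by rewrite subn_gt0.
  by rewrite (leq_trans (leq_subr _ _)) // -ltnS.
by rewrite subnKC // ltnW.
Qed.

(** * Transfer from [L] to a central subgroup [A] of finite index *)

Section Transfer.
Variables (G : groupType) (L A : set G) (J : finType) (lam : G -> J).
Hypothesis L1 : L 1.
Hypothesis LM : forall x y, L x -> L y -> L (x * y).
Hypothesis AL : A `<=` L.
Hypothesis A1 : A 1.
Hypothesis AM : forall x y, A x -> A y -> A (x * y).
Hypothesis AC : forall a x, A a -> L x -> commute a x.
Hypothesis lamP : forall x y, L x -> L y -> lam x = lam y <-> A (x / y).

Let P : pred J := fun j => `[< exists2 t, L t & lam t = j >].

Let t (j : J) : G :=
  if pselect (exists2 t, L t & lam t = j) is left h then sval (cid2 h) else 1.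

Let tP j : P j -> L (t j) /\ lam (t j) = j.
Proof.
rewrite /t => /asboolP Pj; case: pselect => // h.
by case: (cid2 h).
Qed.

Let sg x j : J := if P j then lam (t j * x) else j.
Let z x j : G := if P j then t j * x / t (sg x j) else 1.

Let sgP x j : L x -> P j -> P (sg x j).
Proof.
move=> Lx Pj; rewrite /sg Pj; apply/asboolP; exists (t j * x) => //.
by apply: LM => //; case: (tP Pj).
Qed.

Let zA x j : L x -> A (z x j).
Proof.
move=> Lx; rewrite /z; case: ifP => // Pj.
have [Lj _] := tP Pj; have [Ls ls] := tP (sgP Lx Pj).
by apply/lamP => //; [exact: LM|rewrite ls /sg Pj].
Qed.

Let sg_inj x : L x -> injective (sg x).
Proof.
move=> Lx j k; have [Pj|nPj] := boolP (P j); have [Pk|nPk] := boolP (P k).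
- have [[Lj lj] [Lk lk]] := (tP Pj, tP Pk).
  rewrite /sg Pj Pk => /(lamP (LM Lj Lx) (LM Lk Lx)).
  by rewrite invgM mulgA mulgK => /(lamP Lj Lk); rewrite lj lk.
- by move=> e; move: (sgP Lx Pj); rewrite e /sg !(negPf nPk).
- by move=> e; move: (sgP Lx Pk); rewrite -e /sg !(negPf nPj).
- by rewrite /sg (negPf nPj) (negPf nPk).
Qed.

Let zM x y j : L x -> L y -> P j -> z (x * y) j = z x j * z y (sg x j).
Proof.
move=> Lx Ly Pj; have Pj' := sgP Lx Pj.
have sgM : sg (x * y) j = sg y (sg x j).
  have [[Lj _] [Ls _]] := (tP Pj, tP Pj').
  rewrite {1}/sg Pj [RHS]/sg Pj'; apply/lamP.
  - by apply: LM => //; exact: LM.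
  - exact: LM.
  rewrite invgM !mulgA mulgK.
  by have := zA j Lx; rewrite /z Pj.
by rewrite /z Pj Pj' sgM !mulgA mulgVK.
Qed.

Let prod_perm (s s' : seq J) (F : J -> G) :
  (forall j, A (F j)) -> perm_eq s s' ->
  \prod_(j <- s) F j = \prod_(j <- s') F j.
Proof.
move=> AF; have cF i j : commute (F i) (F j) by apply: AC => //; exact: AL.
elim: s s' => [|x s IH] s' ss'.
  by move: ss'; rewrite perm_sym => /perm_nilP->.
have xs' : x \in s' by rewrite -(perm_mem ss') mem_head.
move: ss'; case/splitPr: xs' => a b.
rewrite -[x :: b]cat1s perm_sym perm_catCA /= perm_cons perm_sym => /IH.
rewrite big_cons => ->; rewrite !big_cat /= big_cons !mulgA; congr (_ * _).
exact: commute_prod.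
Qed.

Let s := [seq j <- enum J | P j].
Definition transfer x := \prod_(j <- s) z x j.

(** The cocycle identity [zM] splits each factor, centrality of [A] separates the two products, and
    reindexing along the permutation [sg x] restores the second one. *)
Lemma transferM x y : L x -> L y -> transfer (x * y) = transfer x * transfer y.
Proof.
move=> Lx Ly; rewrite /transfer.
have -> : \prod_(j <- s) z (x * y) j = \prod_(j <- s) (z x j * z y (sg x j)).
  by rewrite /s !big_filter; apply: eq_bigr => j; exact: zM.
rewrite prodgM_commute; last first.
  by move=> i j _ _; apply: AC; [|apply: AL]; exact: zA.
congr (_ * _); rewrite -(big_map (sg x) predT (z y)).
apply: prod_perm => [j|]; first exact: zA.
have us : uniq s by rewrite filter_uniq ?enum_uniq.
have um : uniq (map (sg x) s) by rewrite map_inj_uniq //; exact: sg_inj.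
have sub : {subset map (sg x) s <= s}.
  move=> _ /mapP[j + ->].
  by rewrite !(mem_filter P) !fintype.mem_enum !andbT; exact: sgP.
apply: uniq_perm => //; apply: (uniq_min_size um sub _).2.
by rewrite size_map.
Qed.

(** The number of labels in use, that is, the index of [A] in [L]. *)
Definition transfer_index := size s.

(** A central [a] commutes with each representative, hence fixes every coset and contributes the
    factor [a]. *)
Lemma transfer_central a : A a -> transfer a = a ^+ transfer_index.
Proof.
move=> Aa; rewrite /transfer (eq_big_seq (fun=> a)); last first.
  move=> j; rewrite (mem_filter P) => /andP[Pj _]; rewrite /z Pj /sg Pj.
  have [Lt lt] := tP Pj.
  have -> : lam (t j * a) = j.
    rewrite -[RHS]lt; apply/lamP => //; first by apply: LM => //; exact: AL.
    by rewrite -(AC Aa Lt) mulgK.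
  by rewrite -(AC Aa Lt) mulgK.
by rewrite big_const_seq count_predT iter_mulg_1.
Qed.

Lemma transfer_mem x : L x -> A (transfer x).
Proof. by move=> Lx; apply: (big_ind A) => // j _; exact: zA. Qed.

Lemma transfer_index_bound : (0 < transfer_index <= #|J|)%N.
Proof.
rewrite /transfer_index (size_filter P) cardT count_size andbT -has_count.
apply/hasP; exists (lam 1); first by rewrite fintype.mem_enum.
by apply/asboolP; exists 1.
Qed.

End Transfer.

(** * Dietzmann's lemma for a finite normal set of torsion elements *)

Section Dietzmann.
Variables (G : groupType) (r : seq G) (Q : nat).
Hypothesis rJ : forall x g, x \in r -> x ^ g \in r.
Hypothesis Q0 : (0 < Q)%N.
Hypothesis rQ : forall x, x \in r -> x ^+ Q = 1.

(** Moving powers of [x] to the front conjugates the letters jumped over, and these stay in [r]. *)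
Let collect x k (w : seq G) : {subset w <= r} -> (k <= count_mem x w)%N ->
  exists w', [/\ {subset w' <= r}, (size w' + k = size w)%N &
    \prod_(y <- w) y = x ^+ k * \prod_(y <- w') y].
Proof.
elim: w k => [|y w IH] [|k] wr //=; try by exists [::]; rewrite mul1g.
  by move=> _; exists (y :: w); rewrite mul1g addn0.
have wr' : {subset w <= r} by move=> v vw; apply: wr; rewrite inE vw orbT.
case: eqVneq => [->|yx] /=.
  rewrite add1n ltnS => /(IH _ wr')[w' [w'r sw' pw']].
  exists w'; split=> //; first by rewrite addnS sw'.
  by rewrite big_cons pw' mulgA expgS.
rewrite add0n => /(IH _ wr')[w' [w'r sw' pw']].
exists (y ^ (x ^+ k.+1) :: w'); split=> [v||].
- rewrite inE => /orP[/eqP->|/w'r//]; apply: rJ; apply: wr; exact: mem_head.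
- by rewrite /= addSn sw'.
- by rewrite !big_cons pw' mulgA (conjgC y (x ^+ k.+1)) -mulgA.
Qed.

(** A word longer than [size r * Q] repeats some letter at least [Q] times; these copies, collected
    at the front, cancel. *)
Lemma shorten_word (w : seq G) : {subset w <= r} ->
  exists w', [/\ {subset w' <= r}, (size w' <= size r * Q)%N &
    \prod_(y <- w) y = \prod_(y <- w') y].
Proof.
have [n] := ubnP (size w); elim: n w => // n IH w; rewrite ltnS => sw wr.
have [|lw] := leqP (size w) (size r * Q); first by exists w.
have [x Qx] : exists x, (Q <= count_mem x w)%N.
  apply: contrapT => nx; move: lw; apply/negP; rewrite -leqNgt.
  have -> : size w = (\sum_(x <- undup r) count_mem x w)%N.
    elim: w wr {sw nx} => [|y w IHw] wr; first by rewrite big1_seq.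
    rewrite big_split /= -IHw; last first.
      by move=> v vw; apply: wr; rewrite inE vw orbT.
    rewrite -[LHS]add1n; congr (_ + _)%N.
    rewrite (bigD1_seq y) ?undup_uniq //=; last first.
      by rewrite mem_undup; apply: wr; exact: mem_head.
    by rewrite eqxx big1 ?addn0 // => v; rewrite eq_sym => /negPf->.
  apply: leq_trans (_ : \sum_(x <- undup r) Q <= _)%N.
    apply: leq_sum => x _; rewrite leqNgt; apply/negP => xQ; apply: nx.
    by exists x; exact: ltnW.
  rewrite big_const_seq count_predT iter_addn_0 mulnC.
  by rewrite leq_mul2r size_undup orbT.
have xr : x \in r.
  apply: wr; rewrite -has_pred1 has_count; exact: leq_trans Qx.
have [w' [w'r sw' pw']] := collect wr Qx.
have [||w2 [w2r sw2 pw2]] // := IH w'.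
  by rewrite (leq_trans _ sw) // -sw' -[X in (X < _)%N]addn0 ltn_add2l.
by exists w2; split=> //; rewrite pw' rQ // mul1g.
Qed.

(** The letter 1 serves as padding, so that shorter products are listed too. *)
Fixpoint products_upto (l : nat) : seq G :=
  if l is l'.+1 then [seq x * y | x <- 1 :: r, y <- products_upto l']
  else [:: 1].

Lemma size_products_upto l : size (products_upto l) = ((size r).+1 ^ l)%N.
Proof.
elim: l => // l IH.
by rewrite /= size_cat size_map size_allpairs IH expnS mulSn.
Qed.

Lemma mem_products_upto l (w : seq G) : {subset w <= r} -> (size w <= l)%N ->
  \prod_(y <- w) y \in products_upto l.
Proof.
elim: l w => [|l IH] [|x w] wr // lw.
- by rewrite big_nil mem_head.
- rewrite big_nil -[1]mulg1; apply: allpairs_f; first exact: mem_head.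
  by have := IH [::] wr isT; rewrite big_nil.
- rewrite big_cons; apply: allpairs_f; last first.
    by apply: IH => // v vw; apply: wr; rewrite inE vw orbT.
  by rewrite inE wr ?orbT // mem_head.
Qed.

End Dietzmann.

(** * Evaluation of words *)

Section WordValues.
Variable G : groupType.
Implicit Types (w u v : word) (g : nat -> G).

Lemma gmulf_word_eval (H : groupType) (f : UMagmaMorphism.type G H) w g :
  f (word_eval w g) = word_eval w (f \o g).
Proof.
rewrite /word_eval gmulf_prod; apply: eq_bigr => l _ /=.
by case: l.2 => //; rewrite gmulfV.
Qed.

Lemma word_eval_conj w g h : word_eval w (fun i => g i ^ h) = word_eval w g ^ h.
Proof.
rewrite /word_eval conjg_prod; apply: eq_bigr => l _ /=.
by case: l.2 => //; rewrite conjVg.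
Qed.

Lemma word_eval_inv w g : word_eval (word_inv w) g = (word_eval w g)^-1.
Proof.
rewrite /word_eval /word_inv; elim: w => [|l w IH].
  by rewrite !big_nil invg1.
rewrite /= rev_cons -cats1 big_cat IH /= !big_cons big_nil mulg1 invgM.
by congr (_ * _); case: l.2 => //=; rewrite invgK.
Qed.

Lemma word_eval_comm u v g :
  word_eval (word_comm u v) g = [~ word_eval u g, word_eval v g].
Proof. by rewrite {1}/word_eval !big_cat -!/(word_eval _ _) !word_eval_inv. Qed.

Lemma eq_word_eval w g h :
  {in word_vars w, g =1 h} -> word_eval w g = word_eval w h.
Proof.
by move=> gh; apply: eq_big_seq => l lw; rewrite gh //; exact: map_f.
Qed.

Lemma word_eval_one w : word_eval w (fun=> 1 : G) = 1.
Proof. by apply: big1 => l _; rewrite invg1 if_same. Qed.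

Lemma word_valuesJ w (x h : G) : word_values w x -> word_values w (x ^ h).
Proof.
by move=> [g _ <-]; exists (fun i => g i ^ h) => //; exact: word_eval_conj.
Qed.

Lemma word_values_one w : @word_values G w 1.
Proof. by exists (fun=> 1); rewrite ?word_eval_one. Qed.

(** Disjointness of the variables allows independent assignments for [u] and [v] to be glued into
    one. *)
Lemma word_values_comm u v : disjoint_vars u v ->
  @word_values G (word_comm u v) =
  [set [~ a, b] | a in word_values u & b in word_values v].
Proof.
move=> uv; apply/seteqP; split=> [_ [g _ <-]|_ [_ [g _ <-]] [_ [h _ <-]] <-].
  exists (word_eval u g); first by exists g.
  by exists (word_eval v g); [exists g|rewrite word_eval_comm].
exists (fun i => if i \in word_vars u then g i else h i) => //.
rewrite word_eval_comm; congr [~ _, _]; apply: eq_word_eval => i iv.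
  by rewrite iv.
by case: ifP => // iu; case: (uv i).
Qed.

End WordValues.

(* Substituting 1 for the other variables evaluates v to x^e, where e is the
   exponent sum of the remaining one. *)
Lemma word_values_power v : non_commutator_word v ->
  exists2 E, (0 < E)%N & forall (G : groupType) (x : G), word_values v (x ^+ E).
Proof.
case=> i _ vi.
pose g (G : groupType) (x : G) j := if j == i then x else 1.
(* [p] and [q] count the occurrences of the letters [x_i] and [x_i^-1] in [v]. *)
have [p [q [vE gE]]] : exists p q, exponent_sum v i = (p%:R - q%:R)%R /\
    forall (G : groupType) (x : G), word_eval v (g G x) = x ^+ p / x ^+ q.
  rewrite /exponent_sum /word_eval; elim: v {vi} => [|l v [p [q [vE gE]]]].
    by exists 0%N, 0%N; split=> [|G x]; rewrite !big_nil ?subrr // divgg.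
  have [li|li] := eqVneq l.1 i; last first.
    exists p, q; split=> [|G x]; rewrite big_cons ?(negPf li) //.
    by rewrite gE /g (negPf li) invg1 if_same mul1g.
  case: (boolP l.2) => l2.
    exists p, q.+1; split=> [|G x].
      by rewrite big_cons li eqxx vE l2 expr1 addrC -[in RHS]natr1 opprD addrA.
    rewrite big_cons gE /g li eqxx l2 expgSr invgM !mulgA; congr (_ * _).
    by apply/commute_sym/commuteV/commute_sym/commuteX.
  exists p.+1, q; split=> [|G x].
    by rewrite big_cons li eqxx vE (negPf l2) expr0 -[in RHS]nat1r addrA.
  by rewrite big_cons gE /g li eqxx (negPf l2) expgS mulgA.
have [pq|qp|pq] := ltngtP p q.
(* For a negative exponent sum, evaluation at [x^-1] makes the exponent positive. *)
- exists (q - p)%N => [|G x]; first by rewrite subn_gt0.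
  exists (g G x^-1) => //; rewrite gE !expVgn invgK.
  by rewrite expgnFr ?(ltnW pq) //; apply/commute_sym/commuteV/commuteX2.
- exists (p - q)%N => [|G x]; first by rewrite subn_gt0.
  by exists (g G x) => //; rewrite gE expgnFr // ltnW.
- by case: vi; rewrite vE pq subrr.
Qed.

(** * Finite sets and closed subgroups *)

Lemma card_le_seqP (T : choiceType) (A : set T) m :
  A #<= `I_m -> exists2 r : seq T, (size r <= m)%N & A = [set` r].
Proof.
move=> Am; have /finite_seqP[s As] : finite_set A.
  exact: card_le_finite Am (finite_II m).
exists (undup s); last first.
  by rewrite As; apply/seteqP; split=> x /=; rewrite mem_undup.
have /pcard_leP[f] := Am.
have : {subset map f (undup s) <= iota 0 m}.
  move=> _ /mapP[x + ->]; rewrite mem_undup mem_iota => xs /=.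
  by have := @funS _ _ _ _ f x; apply; rewrite As.
move/uniq_leq_size; rewrite size_map size_iota; apply.
rewrite map_inj_in_uniq ?undup_uniq // => x y; rewrite !mem_undup => xs ys.
by apply: (@inj _ _ A f); rewrite As inE.
Qed.

Lemma card_le_size (T : choiceType) (A : set T) (r : seq T) :
  A `<=` [set` r] -> A #<= `I_(size r).
Proof.
case: r => [|x0 r] Ar.
  have -> : A = set0 by rewrite -subset0 => x /Ar.
  exact: card_ge0.
apply: card_le_trans (card_image_le (nth x0 (x0 :: r)) _).
apply: subset_card_le => x Ax; have xr : x \in x0 :: r by exact: Ar.
by exists (index x (x0 :: r)); [move: xr; rewrite -index_mem|exact: nth_index].
Qed.

(** On [S] the map [h] factors through [phi], so one representative per label covers the image. *)
Lemma card_image_le_fin (T : Type) (U : choiceType) (F : finType)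
    (phi : T -> F) (h : T -> U) (S : set T) :
  (forall x y, S x -> S y -> phi x = phi y -> h x = h y) ->
  h @` S #<= `I_#|F|.
Proof.
move=> phih.
have [[x0 Sx0]|S0] := pselect (exists x, S x); last first.
  have -> : h @` S = set0; last exact: card_ge0.
  by rewrite -subset0 => y [x Sx _]; case: S0; exists x.
have /choice[t tP] (j : F) :
    exists x, (exists2 y, S y & phi y = j) -> S x /\ phi x = j.
  have [[x Sx xj]|nS] := pselect (exists2 y, S y & phi y = j).
    by exists x.
  by exists x0 => /nS.
rewrite cardE -(size_map (h \o t)); apply: card_le_size => _ [x Sx <-] /=.
have [|St e] := tP (phi x); first by exists x.
by apply/mapP; exists (phi x); [rewrite fintype.mem_enum|apply: phih].
Qed.

Lemma closed_preimage1 (T : topologicalType) (G : profiniteGroupType)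
    (f : T -> G) :
  continuous f -> closed [set x | f x = 1].
Proof.
move=> cf; have -> : [set x | f x = 1] = f @^-1` [set (1 : G)]%classic by [].
refine (preimage_closed (in1W cf) _).
apply: accessible_closed_set1; apply: hausdorff_accessible.
exact: profinite_hausdorff.
Qed.

Lemma continuous_commg (G : topologicalGroupType) (x : G) :
  continuous (fun g : G => [~ g, x]).
Proof.
have cst (y : G) : continuous (fun _ : G => y) by exact: cst_continuous.
have id : continuous (fun g : G => g) by move=> z; exact: cvg_id.
exact: continuous_mulg (continuous_invg id)
  (continuous_mulg (cst x^-1) (continuous_mulg id (cst x))).
Qed.

Lemma continuous_expg (G : topologicalGroupType) n :
  continuous (fun g : G => g ^+ n).
Proof.
elim: n => [|n IH]; first exact: cst_continuous.
have -> : (fun g : G => g ^+ n.+1) = fun g => g * g ^+ n.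
  by apply/funext => g; rewrite expgS.
by apply: (continuous_mulg _ IH) => z; exact: cvg_id.
Qed.

Definition centralizer (G : groupType) (S : set G) : set G :=
  [set g | forall x, S x -> commute g x].

Lemma closed_centralizer (G : profiniteGroupType) (S : set G) :
  closed (centralizer S).
Proof.
have -> : centralizer S = \bigcap_(x in S) [set g | [~ g, x] = 1].
  apply/seteqP; split=> g gS x Sx; first exact/eqP/commgP/gS.
  exact/commgP/eqP/gS.
apply: closed_bigI => x Sx; apply: closed_preimage1.
exact: continuous_commg.
Qed.

Section Centralizer.
Variables (G : groupType) (S : set G).

Lemma centralizer_closed : group_closed (mem (centralizer S)).
Proof.
apply/group_closed_mem; split=> [x _|x y Cx Cy z Sz|x Cx z Sz].
- exact/commute_sym/commute1.
- by apply/commute_sym/commuteM; apply/commute_sym; [exact: Cx|exact: Cy].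
- exact/commute_sym/commuteV/commute_sym/Cx.
Qed.

Lemma centralizerJ : (forall x g, S x -> S (x ^ g)) ->
  forall x g, centralizer S x -> centralizer S (x ^ g).
Proof.
move=> SJ x g Cx y Sy; rewrite -[y](conjgKV g).
by rewrite /commute -!conjMg (Cx (y ^ g^-1)) //; exact: SJ.
Qed.

End Centralizer.

Lemma verbal_subgroup_closed (G : topologicalGroupType) (w : word) :
  group_closed (mem (@verbal_subgroup G w)).
Proof.
apply/group_closed_mem; split=> [H|x y Hx Hy H HH|x Hx H HH].
- by case=> [[/group_closed_mem[]]].
- have [[/group_closed_mem[_ HM _] _] _] := HH.
  by apply: HM; [exact: Hx|exact: Hy].
- have [[/group_closed_mem[_ _ HV] _] _] := HH.
  by apply: HV; exact: Hx.
Qed.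

(** * The values of a commutator word *)

Section FiniteConjugationInvariantSet.
Variables (G : groupType) (m : nat) (r : seq G).
Hypothesis rm : (size r <= m)%N.
Hypothesis rJ : forall x g, x \in r -> x ^ g \in r.

(** The target depends on [m] only, which keeps all later bounds uniform in [G]. It has [m.+1]
    elements because [index] returns [size r] off the list. *)
Definition position (x : G) : 'I_m.+1 := inord (index x r).

Lemma position_inj x y : x \in r -> y \in r -> position x = position y -> x = y.
Proof.
move=> xr yr /(congr1 val); rewrite /= !inordK.
- exact: index_inj.
- by rewrite ltnS (leq_trans _ rm) // index_size.
- by rewrite ltnS (leq_trans _ rm) // index_size.
Qed.

Definition conj_label (g : G) : {ffun 'I_m.+1 -> 'I_m.+1} :=
  [ffun i => position (nth 1 r (nat_of_ord i) ^ g)].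

(** Equal labels mean equal conjugation action on [r]. Labels thus index right cosets of the
    centralizer, as the transfer requires. *)
Lemma conj_labelP x y :
  conj_label x = conj_label y <-> centralizer [set` r] (x / y).
Proof.
split=> [/ffunP xy c cr|Cxy].
  have ci : (index c r < m.+1)%N by rewrite ltnS (leq_trans _ rm) // index_size.
  have := xy (Ordinal ci); rewrite !ffunE /= nth_index //.
  move/position_inj => /(_ (rJ _ cr) (rJ _ cr)) cxy.
  apply/commute_sym/conjg_id_commute.
  by rewrite conjgM cxy conjgK.
apply/ffunP => i; rewrite !ffunE; congr position.
(* Beyond the list [nth] returns 1, which every conjugation fixes. *)
have [ir|ir] := leqP (size r) i; first by rewrite nth_default // !conj1g.
have /commute_sym/conjg_id_commute := Cxy _ (mem_nth 1 ir).
by rewrite conjgM => /(congr1 (fun c => c ^ y)); rewrite conjgKV.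
Qed.

Lemma centralizer_power g :
  centralizer [set` r] (g ^+ (#|{ffun 'I_m.+1 -> 'I_m.+1}|)`!).
Proof.
have [i [d [d0 dJ /conj_labelP Cd]]] :=
  pigeonhole_period (fun i => conj_label (g ^+ i)).
have /divnK <- : (d %| (#|{ffun 'I_m.+1 -> 'I_m.+1}|)`!)%N.
  by rewrite dvdn_fact // d0.
have [_ CM CV] := (group_closed_mem _).1 (centralizer_closed [set` r]).
rewrite mulnC expgnA => c cr; apply/commute_sym/commuteX.
have -> : g ^+ d = (g ^+ i / g ^+ (i + d))^-1.
  by rewrite invgF addnC expgnDr mulgK.
exact/commute_sym/CV.
Qed.

End FiniteConjugationInvariantSet.

(** The factor [E] turns powers into values of [v]; the factorial absorbs any period among the
    [m.+1] positions. *)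
Definition exponent_bound (E m : nat) : nat := E * (m.+1)`!.

Section Main.
Variables (G : profiniteGroupType) (u v : word) (m E : nat) (r : seq G).
Hypothesis uv : disjoint_vars u v.
Hypothesis E0 : (0 < E)%N.
Hypothesis vE : forall x : G, word_values v (x ^+ E).
Hypothesis rm : (size r <= m)%N.
Hypothesis rE : word_values (word_comm u v) = [set` r].

Local Notation M := m.+1.
Local Notation J := {ffun 'I_M -> 'I_M}.
Local Notation N := (exponent_bound E m).
Local Notation X := [set` r].
Local Notation U := (@word_values G u).
Local Notation V := (@word_values G v).

Let rcomm a b : U a -> V b -> [~ a, b] \in r.
Proof.
move=> Ua Vb; suff : [set` r] [~ a, b] by [].
by rewrite -rE word_values_comm //; exists a => //; exists b.
Qed.

Let rcommP c : c \in r -> exists a b, [/\ U a, V b & c = [~ a, b]].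
Proof.
move=> cr; have : word_values (word_comm u v) c by rewrite rE.
by rewrite word_values_comm // => -[a Ua [b Vb <-]]; exists a, b.
Qed.

Let rJ x g : x \in r -> x ^ g \in r.
Proof.
move=> xr; suff : [set` r] (x ^ g) by [].
by rewrite -rE; apply: word_valuesJ; rewrite rE.
Qed.

(** Two of the commutators of [a] with the powers of [g ^+ E] coincide, so [a] commutes with
    [g ^+ (d * E)] for some positive [d] at most [M]. *)
Let commute_power a g : U a -> commute a (g ^+ N).
Proof.
move=> Ua.
have [i [d [d0 dM]]] :=
  pigeonhole_period (fun i => position m r [~ a, (g ^+ i) ^+ E]).
rewrite card_ord in dM.
move/position_inj => /(_ rm (rcomm Ua (vE _)) (rcomm Ua (vE _))).
rewrite -!expgnA mulnC [((i + d) * E)%N]mulnC mulnDr addnC expgnDr.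
move=> /mulgI; rewrite conjgM => /conjg_inj/esym/conjg_id_commute cad.
rewrite /N.
have /divnK <- : (d %| M`!)%N by rewrite dvdn_fact // d0.
by rewrite mulnCA mulnC expgnA; apply: commuteX.
Qed.

Let K := centralizer X.
Let L := centralizer K.
Let A := K `&` L.

Let KJ x g : K x -> K (x ^ g).
Proof. by apply: centralizerJ => *; exact: rJ. Qed.
Let LJ x g : L x -> L (x ^ g).
Proof. by apply: centralizerJ => *; exact: KJ. Qed.
Let K1 : K 1. Proof. by case/group_closed_mem: (centralizer_closed X). Qed.
Let KM x y : K x -> K y -> K (x * y).
Proof. by case/group_closed_mem: (centralizer_closed X) => _ + _; apply. Qed.
Let KV x : K x -> K x^-1.
Proof. by case/group_closed_mem: (centralizer_closed X) => _ _; apply. Qed.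
Let L1 : L 1. Proof. by case/group_closed_mem: (centralizer_closed K). Qed.
Let LM x y : L x -> L y -> L (x * y).
Proof. by case/group_closed_mem: (centralizer_closed K) => _ + _; apply. Qed.
Let LV x : L x -> L x^-1.
Proof. by case/group_closed_mem: (centralizer_closed K) => _ _; apply. Qed.
Let LX x n : L x -> L (x ^+ n).
Proof. by move=> Lx; elim: n => [//|n IH]; rewrite expgS; apply: LM. Qed.
Let KX x n : K x -> K (x ^+ n).
Proof. by move=> Kx; elim: n => [//|n IH]; rewrite expgS; apply: KM. Qed.
Let KL k l : K k -> L l -> commute k l.
Proof. by move=> Kk Ll; apply/commute_sym/Ll. Qed.
Let rL c : c \in r -> L c.
Proof. by move=> cr k Kk; apply/commute_sym/Kk. Qed.

Let Om : set G := [set x | [/\ K x, L x & x ^+ N = 1]].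

Let Om1 : Om 1. Proof. by split=> //; exact: expg1n. Qed.
Let OmM x y : Om x -> Om y -> Om (x * y).
Proof.
move=> [Kx Lx xN] [Ky Ly yN]; split; [exact: KM|exact: LM|].
by rewrite expgMn ?xN ?yN ?mulg1 //; exact: KL.
Qed.
Let OmV x : Om x -> Om x^-1.
Proof.
by move=> [Kx Lx xN]; split; [exact: KV|exact: LV|rewrite expVgn xN invg1].
Qed.
Let OmJ x g : Om x -> Om (x ^ g).
Proof.
by move=> [Kx Lx xN]; split; [exact: KJ|exact: LJ|rewrite -conjXg xN conj1g].
Qed.
Let Om_closed : closed Om.
Proof.
have -> : Om = (K `&` L) `&` [set x | x ^+ N = 1].
  by apply/seteqP; split=> x; [case|case; case].
apply: closedI; first by apply: closedI; exact: closed_centralizer.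
exact/closed_preimage1/continuous_expg.
Qed.

(** A quotient of two values of [v] need not be a value of [v]; this larger set is closed under
    products and inverses and still has its commutators with values of [u] in [L]. *)
Let Vs : set G := [set b | forall a, U a -> L [~ a, b]].

Let VVs b : V b -> Vs b.
Proof. by move=> Vb a Ua; apply: rL; exact: rcomm. Qed.
Let VsM x y : Vs x -> Vs y -> Vs (x * y).
Proof.
by move=> Vx Vy a Ua; rewrite commgMJ; apply: LM; [exact: Vy|apply/LJ/Vx].
Qed.
Let VsV x : Vs x -> Vs x^-1.
Proof. by move=> Vx a Ua; rewrite commgV; apply/LJ/LV/Vx. Qed.

(** Normality of [K] puts [[~ a, g]] in [K]. Being also in [L], it commutes with [g], so its [N]-th
    power is [[~ a, g ^+ N]], which is trivial. *)
Let comm_Om a g : U a -> K g -> Vs g -> Om [~ a, g].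
Proof.
move=> Ua Kg Vg; have La : L [~ a, g] := Vg _ Ua.
split=> //; first by rewrite commgEr; apply: KM => //; apply/KJ/KV.
rewrite -commutatorX_r; last exact/commute_sym/KL.
exact/eqP/commgP/commute_power.
Qed.

Let D_set : set G := [set g | forall b, V b -> Om [~ g, b]].

Let D_group : group_closed (mem D_set).
Proof.
apply/group_closed_mem; split=> [b _|x y Dx Dy b Vb|x Dx b Vb].
- by rewrite comm1g.
- by rewrite commMgJ; apply: OmM; [apply/OmJ/Dx|exact: Dy].
- by rewrite commVg; apply/OmJ/OmV/Dx.
Qed.

Let D_conj x g : D_set x -> D_set (x ^ g).
Proof.
move=> Dx b Vb; rewrite -[b](conjgKV g) -conjRg.
by apply/OmJ/Dx/word_valuesJ.
Qed.

Let D_closed : closed D_set.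
Proof.
have -> : D_set = \bigcap_(b in V) ((fun g : G => [~ g, b]) @^-1` Om) by [].
apply: closed_bigI => b _.
by apply: (preimage_closed _ Om_closed) => x _; exact: continuous_commg.
Qed.

Definition centralizer_mod_torsion := ClosedNormal D_group D_conj D_closed.
Local Notation D := centralizer_mod_torsion.

(** One value of [v] per class modulo [K]; an unattained label receives 1, itself a value of [v]. *)
Let rep : {b : J -> G | forall j, V (b j) /\
  forall b', V b' -> conj_label m r b' = j -> conj_label m r (b j) = j}.
Proof.
apply: cid; have /choice[b bP] (j : J) : exists b, V b /\
    forall b', V b' -> conj_label m r b' = j -> conj_label m r b = j.
  have [[b Vb bj]|nb] := pselect (exists2 b, V b & conj_label m r b = j).
    by exists b.
  exists 1; split=> [|b' Vb' b'j]; first exact: word_values_one.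
  by case: nb; exists b'.
by exists b.
Qed.

Let phi (a : G) : {ffun J -> 'I_M} :=
  [ffun j => position m r [~ a, sval rep j]].

(** Write [b = b' * g] with [b'] the chosen representative and [g] in [K]. Then [[~ a, b] = [~ a, g]
    * [~ a, b']], and likewise for [a']; the second factors agree and the first lie in [Om]. *)
Let phi_coset a a' : U a -> U a' -> phi a = phi a' -> coset D a = coset D a'.
Proof.
move=> Ua Ua' /ffunP e; apply/cosetP.
suff Da : D_set (a' / a).
  have := D_conj a Da; rewrite /conjg.
  by rewrite mulgVK.
move=> b Vb.
have [Vb' /(_ b Vb erefl) lb] := svalP rep (conj_label m r b).
move: (e (conj_label m r b)); rewrite !ffunE.
move/position_inj => /(_ rm (rcomm Ua Vb') (rcomm Ua' Vb')).
set b' := sval rep _ in Vb' lb * => {}e.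
set g := b'^-1 * b.
have Kg : K g.
  have -> : g = (b / b') ^ b by rewrite /conjg -mulgA mulKg.
  apply: KJ; exact/(conj_labelP rm rJ).
have Vg : Vs g by apply: VsM; [apply/VsV/VVs|exact: VVs].
have split_comm x : U x -> [~ x, b] = [~ x, g] * [~ x, b'].
  move=> Ux; have -> : b = b' * g by rewrite /g mulVKg.
  rewrite commgMJ; congr (_ * _); apply/conjg_id_commute/commute_sym/KL => //.
  exact/rL/rcomm.
rewrite commMgJ commVg -conjMg; apply: OmJ.
rewrite !split_comm // e invgM mulgA mulgK.
by apply: OmM; [|apply: OmV]; exact: comm_Om.
Qed.

Lemma card_word_values_quotient :
  @word_values (quotient_group D) u #<= `I_#|{ffun J -> 'I_M}|.
Proof.
have -> : @word_values (quotient_group D) u = coset D @` U.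
  apply/seteqP; split=> [_ [g _ <-]|_ [_ [g _ <-] <-]]; last first.
    by rewrite gmulf_word_eval; exists (coset D \o g).
  exists (word_eval u (repr \o g)); first by exists (repr \o g).
  rewrite gmulf_word_eval; apply: eq_word_eval => i _ /=; exact: reprK.
exact: card_image_le_fin phi_coset.
Qed.

(** * Bounding the order of the values and the verbal subgroup *)

Section Torsion.
Variable q : nat.
Hypothesis uq : @verbal_subgroup (quotient_group D) u #<= `I_q.

(** As [[~ a, b]] is [a^-1 * a ^ b], the powers of its image lie in the verbal subgroup of [u] in
    the quotient, so two of the first [q.+1] exponents or their successor give equal powers. *)
Let coset_power c : c \in r -> D_set (c ^+ (q.+1)`!).
Proof.
move=> cr; have [a [b [Ua Vb ->]]] := rcommP cr.
set c' := [~ a, b].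
have [s sq sE] := card_le_seqP uq.
have [H1 HM HV] := (group_closed_mem _).1
  (@verbal_subgroup_closed (quotient_group D) u).
have Hu x : U x -> verbal_subgroup u (coset D x).
  move=> [g _ <-]; apply: sub_gen_smallest; exists (coset D \o g) => //.
  by rewrite gmulf_word_eval.
have Hc n : coset D c' ^+ n \in s.
  suff : [set` s] (coset D c' ^+ n) by [].
  rewrite -sE; elim: n => [//|n IH]; rewrite expgS; apply: (HM) => //.
  rewrite /c' commgEl gmulfM gmulfV; apply: HM; first by apply: HV; exact: Hu.
  by apply: Hu; exact: word_valuesJ.
have [i [d [d0 dq]]] :=
  pigeonhole_period (fun i => position q s (coset D c' ^+ i)).
rewrite card_ord in dq.
move/position_inj => /(_ sq (Hc _) (Hc _)).
rewrite -!gmulfXn => /cosetP; rewrite expgnDr mulKg => Dd.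
have /divnK <- : (d %| (q.+1)`!)%N by rewrite dvdn_fact // d0.
have [D1 DM _] := (group_closed_mem _).1 D_group.
rewrite mulnC expgnA; elim: (_ %/ _)%N => [//|n IH]; rewrite expgS; exact: DM.
Qed.

(** The first factorial brings a value into [D], the second into [K]; the factor [N] then kills its
    commutators with values of [v], which lie in [Om]. *)
Definition central_exponent : nat := (q.+1)`! * (#|J|)`! * N.

Let central c b : c \in r -> V b ->
  A (c ^+ central_exponent) /\ commute (c ^+ central_exponent) b.
Proof.
move=> cr Vb; set c1 := c ^+ ((q.+1)`! * (#|J|)`!).
have Kc1 : K c1 by rewrite /c1 expgnA; exact: centralizer_power.
have Lc1 : L c1 by apply/LX/rL.
have [D1 DM _] := (group_closed_mem _).1 D_group.
have Dc1 : D_set c1.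
  rewrite /c1 expgnA; elim: (#|J|)`! => [//|n IH]; rewrite expgS.
  apply: (DM) => //.
  exact: coset_power.
rewrite /central_exponent expgnA -/c1.
split; first by split; [exact: KX|exact: LX].
have [Kcb _ cbN] := Dc1 b Vb.
by apply/commgP/eqP; rewrite commutatorX_l //; exact: KL.
Qed.

Lemma torsion_word_values c : c \in r ->
  c ^+ (central_exponent * (#|J|)`! * N) = 1.
Proof.
move=> cr; have [a [b [Ua Vb cE]]] := rcommP cr.
have A1 : A 1 by [].
have AM x y : A x -> A y -> A (x * y).
  by move=> [Kx Lx] [Ky Ly]; split; [exact: KM|exact: LM].
have AL : A `<=` L by move=> x [].
have AC x y : A x -> L y -> commute x y by move=> [Kx _]; exact: KL.
have lamP x y : L x -> L y ->
    conj_label m r x = conj_label m r y <-> A (x / y).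
  move=> Lx Ly; apply: (iff_trans (conj_labelP rm rJ x y)).
  by split=> [Kxy|[]//]; split=> //; apply: LM => //; exact: LV.
pose T := transfer L (conj_label m r).
have TM : forall x y, L x -> L y -> T (x * y) = T x * T y :=
  transferM LM AL A1 AC lamP.
have TA : forall x, L x -> A (T x) := transfer_mem LM A1 AM lamP.
have [n /andP[n0 nJ] Tn] : exists2 n, (0 < n <= #|J|)%N &
    forall x, A x -> T x = x ^+ n.
  exists (transfer_index L (conj_label m r)); first exact: transfer_index_bound.
  exact: transfer_central LM AL AC lamP.
have TX x k : L x -> T (x ^+ k) = T x ^+ k.
  move=> Lx; elim: k => [|k IH]; first by rewrite !expg0 Tn // expg1n.
  by rewrite !expgS TM ?IH //; exact: LX.
set s := central_exponent.
have [As cb] := central cr Vb.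
have Lc := rL cr.
(* Since [c ^+ s] is in [A] and commutes with [b], all conjugates of [c] by powers of [b] have the
   same [s]-th power of their transfer. *)
have TJ k : T (c ^ (b ^+ k)) ^+ s = c ^+ s ^+ n.
  have Lcb : L (c ^ b ^+ k) by exact: LJ.
  rewrite -TX // -conjXg -Tn //; congr T.
  exact/conjg_id_commute/commuteX.
(* [[~ a, b ^+ k]] is a product of [k] such conjugates; for [k = N] it is trivial, whence
   [c ^+ (s * (n * N)) = 1]. *)
have TN k : L [~ a, b ^+ k] /\ T [~ a, b ^+ k] ^+ s = c ^+ s ^+ (n * k).
  elim: k => [|k [Lk IH]].
    by rewrite commg1; split=> //; rewrite Tn // muln0 !expg1n.
  rewrite expgS commgMJ -cE; have LcJ := @LJ c (b ^+ k) Lc.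
  split; first exact: LM.
  rewrite TM // expgMn; last by apply: AC; [exact: TA|apply: AL; exact: TA].
  by rewrite IH TJ mulnS addnC expgnDr.
have [_] := TN N.
have -> : [~ a, b ^+ N] = 1 by apply/eqP/commgP/commute_power.
rewrite Tn // !expg1n => /esym zn.
have /divnK <- : (n %| (#|J|)`!)%N by rewrite dvdn_fact // n0.
set k := (_ %/ n)%N.
have -> : (s * (k * n) * N = s * (n * N) * k)%N.
  by rewrite -!mulnA [(k * _)%N]mulnC -!mulnA.
by rewrite expgnA [c ^+ _]expgnA zn expg1n.
Qed.


(** Torsion turns inverses into positive powers, so the products of values form a subgroup [S]. By
    Dietzmann's lemma [S] is finite, hence closed, and so contains the verbal subgroup. *)
Lemma card_verbal_subgroup_comm :
  @verbal_subgroup G (word_comm u v)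
    #<= `I_(M ^ (m * (central_exponent * (#|J|)`! * N)))%N.
Proof.
set Q := (central_exponent * (#|J|)`! * N)%N.
have Q0 : (0 < Q)%N.
  by rewrite /Q /central_exponent /exponent_bound !muln_gt0 !fact_gt0 E0.
pose S := [set x : G | exists2 w, {subset w <= r} & \prod_(y <- w) y = x].
have rV x : x \in r -> x^-1 = x ^+ Q.-1.
  move=> xr; apply: mulg1_eq; rewrite -expgS prednK //.
  exact: torsion_word_values.
have SS : S `<=` [set` products_upto r (size r * Q)].
  move=> _ [w wr <-].
  have [w' [w'r sw' ->]] := shorten_word rJ Q0 torsion_word_values wr.
  exact: mem_products_upto.
have S1 : S 1 by exists [::]; rewrite ?big_nil.
have SM x y : S x -> S y -> S (x * y).
  move=> [w wr <-] [w' wr' <-]; exists (w ++ w'); last by rewrite big_cat.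
  by move=> z; rewrite mem_cat => /orP[/wr|/wr'].
have SV x : S x -> S x^-1.
  move=> [w + <-]; elim: w => [|y w IH] wr; first by rewrite big_nil invg1.
  have yr : y \in r by apply: wr; exact: mem_head.
  rewrite big_cons invgM (rV y yr); apply: SM.
    by apply: IH => z zw; apply: wr; rewrite inE zw orbT.
  exists (nseq Q.-1 y); first by move=> z; rewrite mem_nseq => /andP[_ /eqP->].
  by rewrite big_nseq iter_mulg_1.
have finS : finite_set S by apply: (sub_finite_set SS); exact: finite_seq.
apply: (@card_le_trans _ _ _ [set` products_upto r (size r * Q)]).
  apply: subset_card_le; apply: subset_trans SS; apply: smallest_sub.
    split; first exact/group_closed_mem.
    have := hausdorff_accessible (@profinite_hausdorff G).
    by move/accessible_finite_set_closed; exact.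
  rewrite rE => x xr; exists [:: x]; last by rewrite big_seq1.
  by move=> z; rewrite inE => /eqP->.
apply: card_le_trans (card_le_size (@subset_refl _ _)) _.
rewrite card_le_II size_products_upto.
apply: (@leq_trans (M ^ (size r * Q))%N).
  by case: (posnP (size r * Q)) => [->//|e0]; rewrite leq_exp2r.
by rewrite leq_pexp2l // leq_mul2r rm orbT.
Qed.

End Torsion.
End Main.

Theorem theorem1p4 (u v : word) (hv : non_commutator_word v)
    (huv : disjoint_vars u v) :
  (concise_in_profinite u -> concise_in_profinite (word_comm u v)) /\
  (boundedly_concise_in_profinite u ->
     boundedly_concise_in_profinite (word_comm u v)).
Proof.
have [E E0 vE] := word_values_power hv.
split=> [cu G fX|bu m].
  have [m Xm] : exists m, @word_values G (word_comm u v) #<= `I_m.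
    by have [m /card_eqPle[]] := fX; exists m.
  have [r rm rE] := card_le_seqP Xm.
  have uD := card_word_values_quotient huv (vE G) rm rE.
  have [q /card_eqPle[uq _]] := cu _ (card_le_finite uD (finite_II _)).
  exact: card_le_finite
    (card_verbal_subgroup_comm huv E0 (vE G) rm uq) (finite_II _).
(* The number of values of [u] in the quotient is bounded through [m] alone, so [q] can be chosen
   before [G]. *)
have [q uq] := bu #|{ffun {ffun 'I_m.+1 -> 'I_m.+1} -> 'I_m.+1}|.
(* The bound is left to unification: it involves only [m], [q] and [E], all fixed before [G]. *)
eexists => G Xm.
have [r rm rE] := card_le_seqP Xm.
apply: (card_verbal_subgroup_comm huv E0 (vE G) rm).
exact/uq/(card_word_values_quotient huv (vE G) rm rE).
Qed.
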